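(* Let $\tilde r(s,x,t)$ (for $s\ge0$, $t>0$, $s+t<1$, $x\in\mathbb{R}$) satisfy the second order partial differential equation $$\min\Bigl(\tilde g_1(x,t)+\tilde r'_s,\ \ \tilde g_2(x,t)+\tilde r'_t+t^{-1}\tilde r+xt^{-1}\tilde r'_x+0.5\,D\,\tilde r''_{xx}\Bigr)=0 .$$ Then it can be expressed as $$\tilde r(s,x,t)=r(s,x,t)\,f_{tD}(x),$$ where $r(s,x,t)$ satisfies the second order partial differential equation $$\min\left(\frac{\partial r}{\partial s}+g_1(x,t),\ \frac{\partial r}{\partial t}+\frac{D}{2}\,\frac{\partial^2 r}{\partial x^2}+g_2(x,t)\right)=0,$$ with $$g_1(x,t)=\int_0^c w\exp\left(D^{-1}(xw-0.5\,tw^2)\right)\varrho(w)\,dw,$$ $$g_2(x,t)=\int_{-c}^0|w|\exp\left(D^{-1}(xw-0.5\,tw^2)\right)\varrho(w)\,dw.$$ The Bayesian risk (in its limiting form given in the context) is expressed as $$R^B_N(\lambda)=N^{1/2}\left(\varepsilon_0\int_{-c}^0|w|\,\varrho(w)\,dw+\int_{-\infty}^{\infty}r(0,x,\varepsilon_0)\,f_{\varepsilon_0D}(x)\,dx\right).$$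
   Context: Gaussian densities: for $V>0$, $f_V(x|a)=(2\pi V)^{-1/2}\exp\{-(x-a)^2/(2V)\}$ and $f_V(x)=f_V(x|0)$. Fix $0<p<1$, $q=1-p$, $D=pq$, $c>0$, and a probability density $\varrho$ on $[-c,c]$. Set $$\tilde g_1(x,t)=\int_0^c w\,f_{tD}(x|wt)\,\varrho(w)\,dw,\qquad \tilde g_2(x,t)=\int_{-c}^0|w|\,f_{tD}(x|wt)\,\varrho(w)\,dw .$$ Primes with subscripts denote partial derivatives, and the functions in the equations are assumed to have the partial derivatives appearing there. Origin: in the Bernoulli one-armed bandit with horizon $N$, incomes are $0/1$-valued, with $\Pr(\xi=1)=p$ (known) for the first action and $\Pr(\xi=1)=p_2=p+wN^{-1/2}$ (unknown), $|w|\le c$, for the second, and prior density $\lambda(p_2)=N^{1/2}\varrho(w)$. The strategy starts by applying the second action $n_0$ times, $n_0=\varepsilon_0N$ with $0<\varepsilon_0<1$. If $k,n$ are the numbers of applications of the first and second actions and $X$ is the cumulative income from the second, the scaled variables are $s=k/N$, $t=n/N$, $x=N^{-1/2}(X-np)$. The function $\tilde r(s,x,t)$ is the limiting form of the Bayesian risk on the remaining horizon multiplied by the marginal probability $P(X,n)=\int\binom{n}{X}p_2^X(1-p_2)^{n-X}\lambda(p_2)\,dp_2$ of the history. The Bayesian risk is expressed, in limiting form, through $\tilde r$ by $$R^B_N(\lambda)=N^{1/2}\left(\varepsilon_0\int_{-c}^0|w|\,\varrho(w)\,dw+\int_{-\infty}^{\infty}\tilde r(0,x,\varepsilon_0)\,dx\right).$$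 *)

(* Defs.v *)
From HB Require Import structures.
From mathcomp Require Import all_boot all_order all_algebra.
From mathcomp Require Import all_classical all_reals all_analysis.
Set Implicit Arguments.
Unset Strict Implicit.
Unset Printing Implicit Defensive.
Import Order.TTheory GRing.Theory Num.Theory.
Import numFieldNormedType.Exports.
Local Open Scope classical_set_scope.
Local Open Scope ring_scope.

(* V is the variance, whereas normal_pdf takes the standard deviation. *)
Definition gauss (R : realType) (V a x : R) : R :=
  (Num.sqrt (2 * pi * V))^-1 * expR (- ((x - a) ^+ 2 / (2 * V))).

Lemma gaussE (R : realType) (V a x : R) :
  0 < V -> gauss V a x = normal_pdf a (Num.sqrt V) x.
Proof.
move=> V0; rewrite normal_pdfE ?gt_eqF ?sqrtr_gt0//.
rewrite /gauss /normal_peak /normal_fun sqr_sqrtr ?ltW// mulNr.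
have -> : V * pi *+ 2 = 2 * pi * V by rewrite -mulr_natl mulrA mulrAC.
by rewrite -[V *+ 2]mulr_natl.
Qed.

Definition is_density_on (R : realType) (c : R) (rho : R -> R) : Prop :=
  [/\ measurable_fun `[- c, c] rho,
      forall w, w \in `[- c, c] -> 0 <= rho w &
      (\int[@lebesgue_measure R]_(w in `[(- c)%R, c%R]) (rho w)%:E = 1)%E].

Section kernels.
Variables (R : realType) (D c : R) (rho : R -> R).
Local Notation mu := (@lebesgue_measure R).

Definition gtilde1 (x t : R) : R :=
  \int[mu]_(w in `[0, c]) (w * gauss (t * D) (w * t) x * rho w).

Definition gtilde2 (x t : R) : R :=
  \int[mu]_(w in `[- c, 0]) (`|w| * gauss (t * D) (w * t) x * rho w).

Definition g1 (x t : R) : R :=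
  \int[mu]_(w in `[0, c])
    (w * expR (D^-1 * (x * w - 2^-1 * t * w ^+ 2)) * rho w).

Definition g2 (x t : R) : R :=
  \int[mu]_(w in `[- c, 0])
    (`|w| * expR (D^-1 * (x * w - 2^-1 * t * w ^+ 2)) * rho w).

End kernels.

(* Derivative at [a >= 0] of a function on [0, +oo[: one-sided at [a = 0], and
   the ordinary derivative when [a > 0]. *)
Section half_line_derivative.
Variable R : realType.
Implicit Types (f : R -> R) (a : R).

Definition dnbhs_ge0 a : set_system R := within [set h | 0 <= h + a] 0^'.

Definition derivable_ge0 f a : Prop :=
  cvg ((fun h => h^-1 *: (f (h + a) - f a)) @ dnbhs_ge0 a).

Definition derive_ge0 f a : R :=
  lim ((fun h => h^-1 *: (f (h + a) - f a)) @ dnbhs_ge0 a).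

Lemma dnbhs_ge0_gt0 a : 0 < a -> dnbhs_ge0 a = 0^'.
Proof.
move=> a0; rewrite eqEsubset; split => A; rewrite /dnbhs_ge0; last first.
  exact: cvg_within.
have H : \forall h \near (0 : R)^', 0 <= h + a.
  apply: nbhs_dnbhs; near=> h; rewrite -lerBlDr sub0r; apply/ltW; near: h.
  by apply: lt_nbhsr; rewrite oppr_lt0.
by move=> nA; apply: filterS2 H nA => h h0; apply.
Unshelve. all: by end_near. Qed.

Lemma dnbhs_ge00 : dnbhs_ge0 0 = 0^'+.
Proof.
rewrite eqEsubset; split => A nA.
- have {}nA : \forall h \near (0 : R), (h != 0 :> R) -> 0 <= h + 0 -> A h.
    exact: nA.
  rewrite /at_right /within /=.
  by apply: filterS nA => h Ah h0; apply: Ah; rewrite ?addr0 ?ltW ?gt_eqF.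
- have {}nA : \forall h \near (0 : R), 0 < h -> A h by exact: nA.
  rewrite /dnbhs_ge0 /dnbhs /within /=.
  apply: filterS nA => h Ah /= hN0; rewrite addr0 le_eqVlt eq_sym.
  by rewrite (negbTE hN0).
Qed.

Lemma derive_ge0E f a : 0 < a -> derive_ge0 f a = derive1 f a.
Proof. by move=> a0; rewrite /derive_ge0 dnbhs_ge0_gt0. Qed.

End half_line_derivative.

(* A function of (s, x, t) is total in Rocq, but only its values on [dom]
   matter: the derivatives below, taken at points of [dom], do not depend on
   the values outside [dom]. *)
Section equations.
Variable R : realType.
Implicit Types (u : R -> R -> R -> R) (s x t : R).

Definition dom s t : Prop := [/\ 0 <= s, 0 < t & s + t < 1].

Definition d_s u s x t : R := derive_ge0 (fun s' => u s' x t) s.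
Definition d_t u s x t : R := derive1 (fun t' => u s x t') t.
Definition d_x u s x t : R := derive1 (fun x' => u s x' t) x.
Definition d_xx u s x t : R := derive1 (fun x' => d_x u s x' t) x.

Definition has_partials u : Prop := forall s x t, dom s t ->
  [/\ derivable_ge0 (fun s' => u s' x t) s,
      derivable (fun t' => u s x t') t 1,
      derivable (fun x' => u s x' t) x 1 &
      derivable (fun x' => d_x u s x' t) x 1].

Definition solves_tilde_eq (D c : R) (rho : R -> R) u : Prop :=
  has_partials u /\
  forall s x t, dom s t ->
    Num.min (gtilde1 D c rho x t + d_s u s x t)
            (gtilde2 D c rho x t + d_t u s x t + t^-1 * u s x t
             + x * t^-1 * d_x u s x t + 2^-1 * D * d_xx u s x t) = 0.

Definition solves_eq (D c : R) (rho : R -> R) u : Prop :=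
  has_partials u /\
  forall s x t, dom s t ->
    Num.min (d_s u s x t + g1 D c rho x t)
            (d_t u s x t + D / 2 * d_xx u s x t + g2 D c rho x t) = 0.

End equations.

(* The limiting form of the Bayesian risk, as a functional of the function u
   (the limiting remaining risk weighted by the marginal of the history).  It is
   extended-real valued, so that a non-integrable u gives no junk real value. *)
Definition limit_bayes_risk (R : realType) (N : nat) (eps0 c : R)
    (rho : R -> R) (u : R -> R -> R -> R) : \bar R :=
  ((Num.sqrt N%:R)%:E *
    ((eps0 * (\int[@lebesgue_measure R]_(w in `[(- c)%R, 0%R])
                (`|w| * rho w))%R)%:E
     + \int[@lebesgue_measure R]_x (u 0%R x eps0)%:E))%E.

(* Main.v *)
Require Import Defs.
From HB Require Import structures.
From mathcomp Require Import all_boot all_order all_algebra.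
From mathcomp Require Import all_classical all_reals all_analysis.
From mathcomp Require Import measurable_realfun ring.
Import Order.TTheory GRing.Theory Num.Theory.
Import numFieldNormedType.Exports.
Local Open Scope classical_set_scope.
Local Open Scope ring_scope.

(* With [f] the Gaussian density of variance [t * D] centred at [0], completing
   the square gives [gtilde_i = f * g_i].  Since [f] does not depend on [s] and
   is annihilated by [d_t + t^-1 + x * t^-1 * d_x + D / 2 * d_xx], the quotient
   [r = rt / f] satisfies the second equation: both arguments of the minimum
   are divided by the positive number [f].  The cross term [D * r'_x * f'_x]
   cancels the drift term [x * t^-1 * r'_x * f]. *)

(** * The Gaussian density: shift of its mean and first derivatives *)

Section gaussian.
Context {R : realType}.
Implicit Types V D a t w x : R.

Lemma gauss_gt0 V a x : 0 < V -> 0 < gauss V a x.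
Proof.
move=> V0; rewrite /gauss mulr_gt0 ?expR_gt0// invr_gt0 sqrtr_gt0.
by rewrite !mulr_gt0// pi_gt0.
Qed.

(** The exponent [(x - w * t)^2 / (2 * t * D)] expands to [x^2 / (2 * t * D)] minus
    [D^-1 * (x * w - t * w^2 / 2)]. *)
Lemma gauss_shiftE D t w x : 0 < D -> 0 < t ->
  gauss (t * D) (w * t) x =
  gauss (t * D) 0 x * expR (D^-1 * (x * w - 2^-1 * t * w ^+ 2)).
Proof.
move=> D0 t0; rewrite /gauss -[RHS]mulrA -expRD; congr (_ * expR _).
by field; rewrite !gt_eqF.
Qed.

Lemma is_derive_gauss_x V x :
  0 < V -> is_derive x 1 (gauss V 0) (- (x / V) * gauss V 0 x).
Proof.
move=> V0; rewrite /gauss.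
have dexp : is_derive x 1 (fun y => - ((y - 0) ^+ 2 / (2 * V))) (- (x / V)).
  under eq_fun do rewrite subr0 -mulNr mulrC mulrN -mulNr.
  apply: is_derive_eq; rewrite /GRing.scale /=.
  by field; rewrite gt_eqF.
apply: is_derive_eq; rewrite /GRing.scale/=; ring.
Qed.

(** The factor is the logarithmic derivative: [x^2 / (2 * t^2 * D)] comes from the exponent and
    [- (2 * t)^-1] from the normalising square root. *)
Lemma is_derive_gauss_t D x t : 0 < D -> 0 < t ->
  is_derive t 1 (fun t => gauss (t * D) 0 x)
    ((x ^+ 2 / (2 * t ^+ 2 * D) - (2 * t)^-1) * gauss (t * D) 0 x).
Proof.
move=> D0 t0.
have pD0 : 0 < 2 * pi * (t * D) by rewrite !mulr_gt0// pi_gt0.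
have dlin : is_derive t 1 (fun t => 2 * pi * (t * D)) (2 * pi * D).
  under eq_fun do rewrite mulrCA mulrC.
  by apply: is_derive_eq; rewrite /GRing.scale/= !mulr1.
have dsqrt := is_derive1_comp (g := fun t => 2 * pi * (t * D))
  (is_derive1_sqrt pD0) dlin.
have sN0 : Num.sqrt (2 * pi * (t * D)) != 0 by rewrite gt_eqF ?sqrtr_gt0.
have dVsqrt :=
  is_deriveV (f := Num.sqrt \o (fun t => 2 * pi * (t * D))) sN0 dsqrt.
have did : is_derive t 1 (fun t => t^-1) (- t ^- 2 *: 1).
  exact: (is_deriveV (f := id) (lt0r_neq0 t0) (is_derive_id _ _)).
have dexp : is_derive t 1 (fun t => - ((x - 0) ^+ 2 / (2 * (t * D))))
    (x ^+ 2 / (2 * t ^+ 2 * D)).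
  have -> : (fun t => - ((x - 0) ^+ 2 / (2 * (t * D)))) =
            (fun t => - (x ^+ 2 / (2 * D)) * t^-1).
    by apply/funext => u; rewrite subr0 (mulrC u) mulrA invfM mulrA mulNr.
  apply: is_derive_eq; rewrite /GRing.scale/=.
  by field; rewrite !gt_eqF.
have dexpR :=
  is_derive1_comp (g := fun t => - ((x - 0) ^+ 2 / (2 * (t * D))))
    (is_derive_expR _) dexp.
apply: is_derive_eq (is_deriveM dVsqrt dexpR) _.
rewrite /GRing.scale/= /gauss/=.
have s2 : Num.sqrt (2 * pi * (t * D)) ^+ 2 = 2 * pi * (t * D).
  by rewrite sqr_sqrtr// ltW.
(* Expressing [pi] through the square root turns the goal into a rational identity in that root. *)
have piE : pi = Num.sqrt (2 * pi * (t * D)) ^+ 2 / (2 * t * D) :> R.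
  by rewrite s2; field; rewrite !gt_eqF.
set S := Num.sqrt _ in sN0 s2 piE *.
rewrite [X in _ * (2 * X * D)]piE.
by field; rewrite sN0 !gt_eqF.
Qed.

End gaussian.

(** * Derivatives of quotients, two-sided and on the half-line *)

Section quotient_derivative.
Context {R : realType}.
Implicit Types f g : R -> R.

(** With [g' = k * g], as for both Gaussian partials, one factor [g a] cancels in the quotient
    rule. *)
Lemma is_derive_div f g (a df k : R) : g a != 0 ->
  is_derive a 1 f df -> is_derive a 1 g (k * g a) ->
  is_derive a 1 (fun y => f y / g y) ((df - k * f a) / g a).
Proof.
move=> g0 fa ga; have gVa := is_deriveV g0 ga.
apply: is_derive_eq (is_deriveM fa gVa) _; rewrite /GRing.scale/=.
by field.
Qed.

Lemma derivable1_is_derive f (a : R) :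
  derivable f a 1 -> is_derive a 1 f (derive1 f a).
Proof. by move=> fa; rewrite derive1E; exact/derivableP. Qed.

(** Properness gives uniqueness of the limit defining [derive_ge0]. *)
Lemma dnbhs_ge0_proper (a : R) : 0 <= a -> ProperFilter (dnbhs_ge0 a).
Proof.
rewrite le_eqVlt => /predU1P[<-|a0].
  by rewrite dnbhs_ge00; exact: at_right_proper_filter.
by rewrite dnbhs_ge0_gt0//; exact: Proper_dnbhs_numFieldType.
Qed.

(** Meant for [k] the inverse of the Gaussian, which is constant in s. The difference quotients
    themselves scale by [k], so the boundary s = 0 is covered. *)
Lemma derive_ge0Mr f (a k : R) : 0 <= a -> derivable_ge0 f a ->
  derivable_ge0 (fun y => f y * k) a /\
  derive_ge0 (fun y => f y * k) a = derive_ge0 f a * k.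
Proof.
move=> a0 fa; have PF := dnbhs_ge0_proper _ a0.
suff H : (fun h => h^-1 *: (f (h + a) * k - f a * k)) @ dnbhs_ge0 a -->
    derive_ge0 f a * k.
  by split; [apply/cvg_ex; eexists; exact: H | exact/cvg_lim].
under eq_fun do rewrite -mulrBl scalerAl.
by apply: cvgM => //; exact: cvg_cst.
Qed.

End quotient_derivative.

(** Nonnegativity takes the place of integrability, since extended-real integrals of nonnegative
    functions are homogeneous. *)
Lemma ge0_RintegralZl d (T : measurableType d) (R : realType)
    (mu : {measure set T -> \bar R}) (A : set T) (f : T -> R) (k : R) :
  measurable A -> measurable_fun A f -> (forall y, A y -> 0 <= f y) -> 0 <= k ->
  \int[mu]_(y in A) (k * f y) = k * \int[mu]_(y in A) f y.
Proof.
move=> mA mf f0 k0; rewrite /Rintegral.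
under eq_integral do rewrite EFinM.
rewrite ge0_integralZl_EFin//; last exact/measurable_EFinP.
have [->|kN0] := eqVneq k 0; first by rewrite mul0e mul0r.
have k_gt0 : (0 < k%:E)%E by rewrite lte_fin lt0r kN0.
(* For [k > 0] an infinite integral stays infinite, and both sides are then the default value 0. *)
by case: integral => [r| |]; rewrite ?gt0_muley ?gt0_muleNy ?mulr0.
Qed.

(** * Factoring the centred Gaussian out of the kernels *)

Section kernels.
Context {R : realType}.
Variables (D c : R) (rho : R -> R).
Hypotheses (D0 : 0 < D) (c0 : 0 < c) (rhoP : is_density_on c rho).
Implicit Types x t : R.

(** The weight [h] stands for w on [[0, c]] and for its absolute value on [[- c, 0]]. *)
Let weighted_kernelE (A : interval R) (h : R -> R) x t : 0 < t ->
  {subset A <= `[- c, c]} -> measurable_fun setT h ->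
  (forall w, w \in A -> 0 <= h w) ->
  \int[@lebesgue_measure R]_(w in [set` A])
    (h w * gauss (t * D) (w * t) x * rho w) =
  gauss (t * D) 0 x * \int[@lebesgue_measure R]_(w in [set` A])
    (h w * expR (D^-1 * (x * w - 2^-1 * t * w ^+ 2)) * rho w).
Proof.
move=> t0 Ac mh h0; have [mrho rho0 _] := rhoP.
rewrite -ge0_RintegralZl//.
- by apply: eq_Rintegral => w _; rewrite gauss_shiftE//; ring.
- apply: measurable_funM; last exact: measurable_funS mrho.
  apply: measurable_funTS; apply: measurable_funM => //.
  apply: measurableT_comp => //; apply: measurable_funM => //.
  apply: measurable_funB; first exact: measurable_funM.
  by apply: measurable_funM => //; exact: measurable_funX.
- by move=> w Aw; rewrite !mulr_ge0 ?h0 ?expR_ge0 ?rho0// Ac.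
- by rewrite ltW// gauss_gt0// mulr_gt0.
Qed.

Lemma gtilde1E x t : 0 < t ->
  gtilde1 D c rho x t = gauss (t * D) 0 x * g1 D c rho x t.
Proof.
move=> t0; apply: (@weighted_kernelE `[0, c] id) => //.
- move=> w; rewrite !in_itv/= => /andP[w0 ->].
  by rewrite andbT (le_trans _ w0)// oppr_le0 ltW.
- by move=> w; rewrite in_itv/= => /andP[].
Qed.

Lemma gtilde2E x t : 0 < t ->
  gtilde2 D c rho x t = gauss (t * D) 0 x * g2 D c rho x t.
Proof.
move=> t0; apply: (@weighted_kernelE `[- c, 0] Num.norm) => //.
by move=> w; rewrite !in_itv/= => /andP[-> w0]/=; rewrite (le_trans w0)// ltW.
Qed.

End kernels.

(** * Partial derivatives of the quotient by the Gaussian *)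

Section gaussian_quotient.
Context {R : realType}.
Variables (D : R) (u : R -> R -> R -> R).
Hypotheses (D0 : 0 < D) (up : has_partials u).
Implicit Types s x t : R.

Definition gauss_quotient s x t := u s x t / gauss (t * D) 0 x.

Local Notation v := gauss_quotient.
Local Notation G t x := (gauss (t * D) 0 x).

Let G_neq0 t x : 0 < t -> G t x != 0.
Proof. by move=> t0; rewrite gt_eqF// gauss_gt0// mulr_gt0. Qed.

Lemma gauss_quotient_s s x t : dom s t ->
  derivable_ge0 (fun s => v s x t) s /\ d_s v s x t = d_s u s x t / G t x.
Proof.
move=> st; have [s0 _ _] := st; have [us _ _ _] := up s x t st.
exact: derive_ge0Mr.
Qed.

Lemma gauss_quotient_t s x t : dom s t ->
  is_derive t 1 (fun t => v s x t)
    ((d_t u s x t - (x ^+ 2 / (2 * t ^+ 2 * D) - (2 * t)^-1) * u s x t)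
     / G t x).
Proof.
move=> st; have [_ t0 _] := st; have [_ ut _ _] := up s x t st.
apply: (is_derive_div (fun t => u s x t) (fun t => G t x));
  [exact: G_neq0|exact: derivable1_is_derive|].
exact: is_derive_gauss_t.
Qed.

Lemma gauss_quotient_x s x t : dom s t ->
  is_derive x 1 (fun x => v s x t)
    ((d_x u s x t + x / (t * D) * u s x t) / G t x).
Proof.
move=> st; have [_ t0 _] := st; have [_ _ ux _] := up s x t st.
have dG := is_derive_gauss_x _ x (mulr_gt0 t0 D0).
have du := derivable1_is_derive _ _ ux.
have := is_derive_div _ _ _ _ _ (G_neq0 _ x t0) du dG.
by rewrite mulNr opprK.
Qed.

Lemma gauss_quotient_xx s x t : dom s t ->
  is_derive x 1 (fun x => d_x v s x t)
    ((d_xx u s x t + 2 * x / (t * D) * d_x u s x t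
      + ((t * D)^-1 + (x / (t * D)) ^+ 2) * u s x t) / G t x).
Proof.
move=> st; have [_ t0 _] := st; have [_ _ ux uxx] := up s x t st.
(* [dom] does not constrain x, so the formula for the first derivative holds at every x and can be
   differentiated again. *)
have -> : (fun x => d_x v s x t) =
    (fun x => (d_x u s x t + x / (t * D) * u s x t) / G t x).
  apply/funext => y; rewrite /d_x derive1E.
  exact: (derive_val (is_derive := gauss_quotient_x s y t st)).
have dux := derivable1_is_derive _ _ uxx.
have du := derivable1_is_derive _ _ ux.
have dlin : is_derive x 1 (fun x => x / (t * D)) (t * D)^-1.
  under eq_fun do rewrite mulrC.
  by apply: is_derive_eq; rewrite /GRing.scale/= mulr1.
have dG := is_derive_gauss_x _ x (mulr_gt0 t0 D0).
have dnum : is_derive x 1 (fun x => d_x u s x t + x / (t * D) * u s x t) _ :=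
  is_deriveD dux (is_deriveM dlin du).
apply: is_derive_eq (is_derive_div _ _ _ _ _ (G_neq0 _ x t0) dnum dG) _.
rewrite /GRing.scale/= -/(d_x u s x t) -/(d_xx u s x t).
by field; rewrite G_neq0// !gt_eqF.
Qed.

Lemma gauss_quotient_partials : has_partials v.
Proof.
move=> s x t st; split.
- by have [] := gauss_quotient_s s x t st.
- exact: (ex_derive (is_derive := gauss_quotient_t s x t st)).
- exact: (ex_derive (is_derive := gauss_quotient_x s x t st)).
- exact: (ex_derive (is_derive := gauss_quotient_xx s x t st)).
Qed.

(** The [x^2] terms of the t- and xx-derivatives cancel, their two terms [(2 * t)^-1 * u] add up to
    [t^-1 * u], and the cross term yields the drift. *)
Lemma gauss_quotient_heat s x t : dom s t ->
  d_t v s x t + D / 2 * d_xx v s x t =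
  (d_t u s x t + t^-1 * u s x t + x * t^-1 * d_x u s x t
   + 2^-1 * D * d_xx u s x t) / G t x.
Proof.
move=> st; have [_ t0 _] := st.
rewrite {1}/d_t derive1E.
rewrite (derive_val (is_derive := gauss_quotient_t s x t st)).
rewrite {1}/d_xx derive1E.
rewrite (derive_val (is_derive := gauss_quotient_xx s x t st)).
by field; rewrite G_neq0// !gt_eqF.
Qed.

End gaussian_quotient.

Theorem theorem5p1 (R : realType) (p q D c : R) (rho : R -> R)
    (rt : R -> R -> R -> R)
    (p_gt0 : 0 < p) (p_lt1 : p < 1) (q_def : q = 1 - p) (D_def : D = p * q)
    (c_gt0 : 0 < c) (rho_density : is_density_on c rho)
    (rt_eq : solves_tilde_eq D c rho rt) :
  exists r : R -> R -> R -> R,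
    [/\ forall s x t : R, dom s t -> rt s x t = r s x t * gauss (t * D) 0 x,
        solves_eq D c rho r &
        forall (N : nat) (eps0 : R), (0 < N)%N -> 0 < eps0 -> eps0 < 1 ->
          limit_bayes_risk N eps0 c rho rt =
          ((Num.sqrt N%:R)%:E *
            ((eps0 * (\int[@lebesgue_measure R]_(w in `[(- c)%R, 0%R])
                        (`|w| * rho w))%R)%:E
             + \int[@lebesgue_measure R]_x
                 (r 0%R x eps0 * gauss (eps0 * D) 0 x)%:E))%E].
Proof.
have D0 : 0 < D by rewrite D_def q_def mulr_gt0// subr_gt0.
have [up ueq] := rt_eq.
have rtE s x t : 0 < t ->
    gauss_quotient D rt s x t * gauss (t * D) 0 x = rt s x t.
  by move=> t0; rewrite divfK// gt_eqF// gauss_gt0// mulr_gt0.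
exists (gauss_quotient D rt); split.
- by move=> s x t [_ t0 _]; rewrite rtE.
- split; first exact: gauss_quotient_partials.
  move=> s x t st; have [_ t0 _] := st.
  have G0 : 0 < gauss (t * D) 0 x by rewrite gauss_gt0// mulr_gt0.
  have := ueq s x t st; rewrite gtilde1E// gtilde2E// => minE.
  have [_ ->] := gauss_quotient_s D rt up s x t st.
  rewrite gauss_quotient_heat//.
  (* Multiplication by the positive Gaussian commutes with the minimum and restores the equation for
     [rt]. *)
  apply: (mulfI (lt0r_neq0 G0)); rewrite mulr0 -[RHS]minE minr_pMr ?ltW//.
  by congr Num.min; field; rewrite !gt_eqF.
(* As [eps0 > 0], the two integrands agree at every x. *)
- move=> N eps0 _ eps0_gt0 _; rewrite /limit_bayes_risk.
  by congr (_ * (_ + _))%E; apply: eq_integral => x _; rewrite rtE.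
Qed.
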